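(* Let $p$ be a prime with $p\equiv 1 \pmod 4$ and $m\ge 1$ an integer. Then the zero-divisor graph $\Gamma(\mathbb{Z}_{p^m}[i])$ is bipancyclic if and only if $m=1$.
   Context: $\mathbb{Z}_n[i]=\mathbb{Z}[i]/\langle n\rangle=\{a+bi : a,b\in\mathbb{Z}_n\}$ with $i^2=-1$. For a finite commutative ring $R$ with unity, $\Gamma(R)$ has vertex set the nonzero zero-divisors of $R$, distinct $x,y$ adjacent iff $xy=0$. A graph of order $N$ is bipancyclic if it contains a cycle of length $k$ for every even $k$ with $4\le k\le N$. *)

(* Defs.v *)
From HB Require Import structures.
From mathcomp Require Import all_boot all_order all_algebra ring.

Set Implicit Arguments.
Unset Strict Implicit.
Unset Printing Implicit Defensive.

Import GRing.Theory.
Local Open Scope ring_scope.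

(* [gaussian R] is R[i] = R[X]/(X^2 + 1): the pair (Gaussian a b) stands for
   a + b i, with i^2 = -1. *)
Record gaussian (R : Type) : Type := Gaussian { gre : R; gim : R }.

Definition gaussian_to_pair (R : Type) (x : gaussian R) : R * R :=
  (gre x, gim x).
Definition gaussian_of_pair (R : Type) (x : R * R) : gaussian R :=
  Gaussian x.1 x.2.

Lemma gaussian_to_pairK (R : Type) :
  cancel (@gaussian_to_pair R) (@gaussian_of_pair R).
Proof. by case. Qed.

HB.instance Definition _ (R : eqType) :=
  Equality.copy (gaussian R) (can_type (@gaussian_to_pairK R)).
HB.instance Definition _ (R : choiceType) :=
  Choice.copy (gaussian R) (can_type (@gaussian_to_pairK R)).
HB.instance Definition _ (R : countType) :=
  Countable.copy (gaussian R) (can_type (@gaussian_to_pairK R)).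
HB.instance Definition _ (R : finType) :=
  Finite.copy (gaussian R) (can_type (@gaussian_to_pairK R)).

Section GaussianZmodule.
Variable R : zmodType.
Implicit Types x y z : gaussian R.

Definition gadd x y := Gaussian (gre x + gre y) (gim x + gim y).
Definition gopp x := Gaussian (- gre x) (- gim x).

Fact gaddA : associative gadd.
Proof. by case=> [? ?] [? ?] [? ?]; rewrite /gadd /= !addrA. Qed.
Fact gaddC : commutative gadd.
Proof. by move=> [a b] [c d]; rewrite /gadd /= (addrC a) (addrC b). Qed.
Fact gadd0 : left_id (Gaussian 0 0) gadd.
Proof. by case=> [? ?]; rewrite /gadd /= !add0r. Qed.
Fact gaddN : left_inverse (Gaussian 0 0) gopp gadd.
Proof. by case=> [? ?]; rewrite /gadd /gopp /= !addNr. Qed.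

HB.instance Definition _ :=
  GRing.isZmodule.Build (gaussian R) gaddA gaddC gadd0 gaddN.

End GaussianZmodule.

Section GaussianRing.
Variable R : comNzRingType.
Implicit Types x y z : gaussian R.

(* (a + b i)(c + d i) = (ac - bd) + (ad + bc) i *)
Definition gmul x y :=
  Gaussian (gre x * gre y - gim x * gim y) (gre x * gim y + gim x * gre y).

Fact gmulA : associative gmul.
Proof. by move=> [a b] [c d] [e f]; rewrite /gmul /=; congr Gaussian; ring. Qed.
Fact gmulC : commutative gmul.
Proof. by move=> [a b] [c d]; rewrite /gmul /=; congr Gaussian; ring. Qed.
Fact gmul1 : left_id (Gaussian 1 0) gmul.
Proof. by move=> [a b]; rewrite /gmul /=; congr Gaussian; ring. Qed.
Fact gmulDl : left_distributive gmul +%R.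
Proof.
move=> x y z; have greD : gre (x + y) = gre x + gre y by [].
have gimD : gim (x + y) = gim x + gim y by [].
by rewrite /gmul greD gimD; congr Gaussian => /=; ring.
Qed.
Fact gone_neq0 : Gaussian 1 0 != 0 :> gaussian R.
Proof. by apply/eqP => -[] /eqP; rewrite oner_eq0. Qed.

HB.instance Definition _ :=
  GRing.Zmodule_isComNzRing.Build (gaussian R) gmulA gmulC gmul1 gmulDl gone_neq0.

End GaussianRing.

HB.instance Definition _ (R : finComNzRingType) :=
  GRing.ComNzRing.on (gaussian R).

Notation "''Zi_' n" := (gaussian 'Z_n)
  (at level 0, n at level 2, format "''Zi_' n") : type_scope.

(* The next facts identify 'Zi_n, for n > 1, with the quotient Z[i]/<n>:
   coefficientwise reduction modulo n is a surjective ring morphism from Z[i]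
   whose kernel is the ideal generated by n. *)
Definition gaussian_red (n : nat) (x : gaussian int) : 'Zi_n :=
  Gaussian (gre x)%:~R (gim x)%:~R.

Lemma gaussian_red_is_zmod_morphism n : zmod_morphism (gaussian_red n).
Proof.
by move=> [a b] [c d]; rewrite /gaussian_red /= !rmorphD /= !rmorphN.
Qed.

Lemma gaussian_red_is_monoid_morphism n : monoid_morphism (gaussian_red n).
Proof.
split=> // -[a b] [c d]; rewrite /gaussian_red /=.
by rewrite !rmorphD /= !rmorphN /= !rmorphM.
Qed.

Lemma gaussian_red_surj n (y : 'Zi_n) : exists x, gaussian_red n x = y.
Proof.
case: y => a b; exists (Gaussian (val a)%:Z (val b)%:Z).
by rewrite /gaussian_red /= -!pmulrn !natr_Zp.
Qed.

Lemma gaussian_red_ker n (x : gaussian int) : (1 < n)%N ->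
  gaussian_red n x = 0 <-> exists y, x = n%:R * y.
Proof.
move=> n_gt1.
have gnat (k : nat) : k%:R = Gaussian k%:R 0 :> gaussian int.
  elim: k => [//|k IHk]; rewrite -!natr1 IHk.
  by rewrite [LHS]/GRing.add /= /gadd /= addr0.
have redE (a : int) : (a%:~R == 0 :> 'Z_n) = (n%:Z %| a)%Z.
  have nat_red k : (k%:R == 0 :> 'Z_n) = (n %| k)%N.
    by rewrite -Zp_nat_mod // -val_eqE /= /dvdn val_Zp_nat // modn_mod.
  case: a => k; first by rewrite -pmulrn nat_red.
  by rewrite NegzE mulrNz oppr_eq0 -pmulrn nat_red dvdzE abszN.
have mulE (a b : int) :
    n%:R * Gaussian a b = Gaussian (n%:Z * a) (n%:Z * b).
  by rewrite gnat [LHS]/GRing.mul /= /gmul /= !mul0r subr0 addr0 natz.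
case: x => a b; split; last first.
  case=> -[c d]; rewrite mulE => -[-> ->]; congr Gaussian; apply/eqP.
  - by rewrite redE dvdz_mulr.
  - by rewrite redE dvdz_mulr.
case=> /eqP; rewrite redE => /dvdzP[c ->] /eqP.
rewrite redE => /dvdzP[d ->].
by exists (Gaussian c d); rewrite mulE ![_ * n%:Z]mulrC.
Qed.

Record sgraph : Type := SGraph {
  vertex :> finType;
  adj : rel vertex;
  adj_sym : symmetric adj;
  adj_irrefl : irreflexive adj
}.

(* A cycle of length k is listed by its k distinct vertices; [3 <= k] excludes
   the degenerate closed walks on fewer than three vertices. *)
Definition has_cycle (G : sgraph) (k : nat) : Prop :=
  (3 <= k)%N /\ exists c : seq G, [/\ size c = k, uniq c & cycle (@adj G) c].

Definition bipancyclic (G : sgraph) : Prop :=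
  forall k : nat, ~~ odd k -> (4 <= k <= #|G|)%N -> has_cycle G k.

Section ZeroDivisorGraph.
Variable R : finComNzRingType.

Definition zero_divisor (x : R) : bool := [exists y : R, (y != 0) && (x * y == 0)].

Definition zdvertex : finType := {x : R | (x != 0) && zero_divisor x}.

Definition zdadj : rel zdvertex :=
  fun x y => (x != y) && (val x * val y == 0).

Fact zdadj_sym : symmetric zdadj.
Proof. by move=> x y; rewrite /zdadj eq_sym mulrC. Qed.

Fact zdadj_irrefl : irreflexive zdadj.
Proof. by move=> x; rewrite /zdadj eqxx. Qed.

Definition zero_divisor_graph : sgraph := SGraph zdadj_sym zdadj_irrefl.

End ZeroDivisorGraph.

(* Main.v *)
(* Since p = 1 mod 4, -1 has a square root j modulo p, hence modulo p^m by
   Newton iteration, and a + b i |-> (a + j b, a - j b) identifies Z_{p^m}[i]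
   with A x A for A = Z_{p^m}.  For m = 1, A is a field and the graph is the
   complete bipartite graph K_{p-1,p-1}.  For m > 1, the vertices (u, 0) and
   (u, p) with u a unit of A have all their neighbours among the p^m - 1
   vertices (0, y).  Along a cycle missing at most one vertex, the successor map
   is injective, so 2 p^{m-1}(p - 1) <= p^m, which is false; whichever of N and
   N - 1 is even is therefore not the length of a cycle. *)
Require Import Defs.
From HB Require Import structures.
From mathcomp Require Import all_boot all_order all_algebra.
From mathcomp Require Import fingroup cyclic ring zify.

Set Implicit Arguments.
Unset Strict Implicit.
Unset Printing Implicit Defensive.

Import GRing.Theory.

(** * Cycles in finite graphs *)

(** The successor map along [c] sends the vertices of [S] on [c] injectively into [T]; the other
    vertices of [S] lie off [c]. *)
Lemma card_le_long_cycle (G : sgraph) (c : seq G) (S T : {set G}) :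
  path.cycle (@adj G) c -> uniq c ->
  (forall x y, x \in S -> adj x y -> y \in T) ->
  #|S| <= #|T| + (#|G| - size c).
Proof.
move=> cyc_c uniq_c ST; pose C := [set x in c].
rewrite -(cardsID C S); apply: leq_add.
  rewrite -(card_imset _ (can_inj (prev_next uniq_c))).
  apply/subset_leq_card/subsetP=> _ /imsetP[x + ->].
  by rewrite !inE => /andP[xS xc]; apply: ST xS _; exact: next_cycle.
have <- : #|C| = size c by rewrite cardsE (card_uniqP uniq_c).
rewrite -(cardC (mem C)) addKn; apply/subset_leq_card/subsetP=> x.
by rewrite !inE => /andP[].
Qed.

(** The tail of the longer list is kept, so the result permutes [s ++ t] whatever the lengths. *)
Fixpoint interleave (T : Type) (s t : seq T) : seq T :=
  if s is x :: s' then if t is y :: t' then [:: x, y & interleave s' t'] else s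
  else t.

Lemma perm_interleave (T : eqType) (s t : seq T) :
  perm_eq (interleave s t) (s ++ t).
Proof.
elim: s t => [|x s IHs] [|y t] //=; first by rewrite cats0.
rewrite perm_cons perm_sym -cat1s perm_catCA /= perm_cons perm_sym; exact: IHs.
Qed.

(** The path alternates between [P] and [Q]; the clause on its endpoint serves to close it into a
    cycle. *)
Lemma path_interleave (T : eqType) (e : rel T) (P Q : {pred T}) (s t : seq T) z :
  symmetric e -> {in P & Q, forall x y, e x y} ->
  size s = size t -> {subset s <= P} -> {subset t <= Q} -> z \in Q ->
  path e z (interleave s t) /\ last z (interleave s t) \in Q.
Proof.
move=> e_sym ePQ; elim: s t z => [|x s IHs] [|y t] z //= [eq_sz] sP tQ zQ.
have xP : x \in P by apply: sP; rewrite inE eqxx.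
have yQ : y \in Q by apply: tQ; rewrite inE eqxx.
have [||//|-> ->] := IHs t y eq_sz.
- by move=> u us; apply: sP; rewrite inE us orbT.
- by move=> u ut; apply: tQ; rewrite inE ut orbT.
by rewrite e_sym !ePQ.
Qed.

Lemma has_even_cycle_bipartite (G : sgraph) (P Q : {set G}) l :
  [disjoint P & Q] -> {in P & Q, forall x y, adj x y} ->
  1 < l -> l <= #|P| -> l <= #|Q| -> has_cycle G l.*2.
Proof.
move=> dPQ ePQ l_gt1 lP lQ; split; first lia.
pose s := take l (enum P); pose t := take l (enum Q).
have sz_s : size s = l by rewrite size_takel // -cardE.
have sz_t : size t = l by rewrite size_takel // -cardE.
have sP : {subset s <= P} by move=> x /mem_take; rewrite mem_enum.
have tQ : {subset t <= Q} by move=> x /mem_take; rewrite mem_enum.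
have perm_st := perm_interleave s t.
exists (interleave s t); split.
- by rewrite (perm_size perm_st) size_cat sz_s sz_t addnn.
- rewrite (perm_uniq perm_st) cat_uniq !take_uniq ?enum_uniq // andbT /=.
  apply/hasPn=> x /tQ xQ; apply/negP=> /sP xP.
  by have /pred0P/(_ x) := dPQ; rewrite /= xP xQ.
case: s t sz_s sz_t sP tQ {perm_st} => [|x s] [|y t] sz_s sz_t sP tQ //=.
- by rewrite -sz_s in l_gt1.
- by rewrite -sz_t in l_gt1.
have xP : x \in P by apply: sP; rewrite inE eqxx.
have yQ : y \in Q by apply: tQ; rewrite inE eqxx.
have eq_sz : size s = size t by apply: succn_inj; rewrite -[LHS]/(size (x :: s)) sz_s.
have [||path_st last_st] := path_interleave (@adj_sym G) ePQ eq_sz _ _ yQ.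
- by move=> u us; apply: sP; rewrite inE us orbT.
- by move=> u ut; apply: tQ; rewrite inE ut orbT.
by rewrite rcons_path ePQ // path_st adj_sym ePQ.
Qed.

(** Cycles of [G] map to cycles of the same length, and the size bound puts every length needed in
    [H] within the range of [G]. *)
Lemma bipancyclic_embedding (G H : sgraph) (f : G -> H) :
  injective f -> {homo f : x y / adj x y} -> #|H| <= #|G| ->
  bipancyclic G -> bipancyclic H.
Proof.
move=> f_inj f_adj leHG bipG k k_even /andP[k_ge4 k_le].
have [||k_ge3 [c [sz_c uniq_c cyc_c]]] := bipG k; rewrite ?k_ge4 //.
  exact: leq_trans leHG.
split=> //; exists (map f c); split; rewrite ?size_map ?map_inj_uniq //.
rewrite cycle_map; apply: sub_cycle cyc_c => x y; exact: f_adj.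
Qed.

Local Open Scope ring_scope.

(** * Transport of zero-divisor graphs along isomorphisms *)

Section ZeroDivisorGraphIso.
Variables (R R' : finComNzRingType) (f : R -> R') (g : R' -> R).
Hypotheses (fK : cancel f g) (f0 : f 0 = 0) (fM : {morph f : x y / x * y}).

Let f_eq0 x : (f x == 0) = (x == 0).
Proof. by rewrite -f0 (can_eq fK). Qed.

Lemma zdvertex_map_proof (v : zdvertex R) :
  (f (val v) != 0) && zero_divisor (f (val v)).
Proof.
case: v => x /= /andP[x_neq0 /existsP[y /andP[y_neq0 xy0]]].
rewrite f_eq0 x_neq0; apply/existsP; exists (f y).
by rewrite -fM !f_eq0 y_neq0.
Qed.

Definition zdvertex_map (v : zdvertex R) : zdvertex R' :=
  Sub (f (val v)) (zdvertex_map_proof v).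

Lemma zdvertex_map_inj : injective zdvertex_map.
Proof. by move=> v w /(congr1 val) /= /(can_inj fK) /val_inj. Qed.

Lemma zdvertex_map_adj : {homo zdvertex_map : x y / zdadj x y}.
Proof.
by move=> v w /andP[vw vw0]; rewrite /zdadj (inj_eq zdvertex_map_inj) vw /= -fM f_eq0.
Qed.

End ZeroDivisorGraphIso.

Lemma bipancyclic_zero_divisor_iso (R R' : finComNzRingType)
    (f : R -> R') (g : R' -> R) :
  cancel f g -> cancel g f -> f 0 = 0 -> {morph f : x y / x * y} ->
  bipancyclic (zero_divisor_graph R) <-> bipancyclic (zero_divisor_graph R').
Proof.
move=> fK gK f0 fM.
have g0 : g 0 = 0 by rewrite -f0 fK.
have gM : {morph g : x y / x * y}.
  by move=> x y; apply: (can_inj fK); rewrite fM !gK.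
have le1 := leq_card _ (@zdvertex_map_inj _ _ _ _ fK f0 fM).
have le2 := leq_card _ (@zdvertex_map_inj _ _ _ _ gK g0 gM).
split.
- exact: (@bipancyclic_embedding (zero_divisor_graph R) (zero_divisor_graph R')
    _ (@zdvertex_map_inj _ _ _ _ fK f0 fM)
    (@zdvertex_map_adj _ _ _ _ fK f0 fM) le2).
- exact: (@bipancyclic_embedding (zero_divisor_graph R') (zero_divisor_graph R)
    _ (@zdvertex_map_inj _ _ _ _ gK g0 gM)
    (@zdvertex_map_adj _ _ _ _ gK g0 gM) le1).
Qed.

HB.instance Definition _ (A : finComNzRingType) := GRing.ComNzRing.on (A * A)%type.

(** * Splitting [A[i]] as [A * A] *)

Section GaussianSplit.
Variables (A : finComNzRingType) (j h : A).
Hypotheses (j_sqr : j * j = -1) (h_half : 2%:R * h = 1).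

(** Evaluation at the two roots [j] and [- j] of X^2 + 1. *)
Definition gaussian_split (x : gaussian A) : A * A :=
  (gre x + j * gim x, gre x - j * gim x).
(** Solves a + jb = u.1, a - jb = u.2, with [h] = 1/2 and 1/j = -j. *)
Definition gaussian_unsplit (u : A * A) : gaussian A :=
  Gaussian (h * (u.1 + u.2)) (h * j * (u.2 - u.1)).

Lemma gaussian_splitK : cancel gaussian_split gaussian_unsplit.
Proof.
by case=> a b; rewrite /gaussian_unsplit /=; congr Gaussian; ring: j_sqr h_half.
Qed.

Lemma gaussian_unsplitK : cancel gaussian_unsplit gaussian_split.
Proof.
by case=> a b; rewrite /gaussian_split /=; congr pair; ring: j_sqr h_half.
Qed.

Lemma gaussian_splitM : {morph gaussian_split : x y / x * y}.
Proof.
move=> [a b] [c d]; rewrite /gaussian_split; congr pair => /=; ring: j_sqr.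
Qed.

Lemma bipancyclic_gaussian_split :
  bipancyclic (zero_divisor_graph (gaussian A)) <->
  bipancyclic (zero_divisor_graph (A * A)%type).
Proof.
apply: (bipancyclic_zero_divisor_iso gaussian_splitK gaussian_unsplitK) gaussian_splitM.
by rewrite /gaussian_split /= mulr0 subr0 addr0.
Qed.

End GaussianSplit.

(** * The product of a field with itself *)

(** A pair with two nonzero coordinates is a unit, so a vertex lies on exactly one of the two
    axes. *)
Lemma zdvertex_prod_field (A : finComUnitRingType) :
  (forall x : A, x != 0 -> x \is a GRing.unit) ->
  forall v : zdvertex (A * A)%type, ((val v).1 == 0) = ((val v).2 != 0).
Proof.
move=> A_field [[a b] /= /andP[ab_neq0 /existsP[[c d] /andP[cd_neq0 /eqP[ac bd]]]]].
have [a0|/A_field a_unit] := eqVneq a 0; have [b0|/A_field b_unit] //= := eqVneq b 0.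
  by move: ab_neq0; rewrite a0 b0 eqxx.
move/(canRL (mulKr a_unit)): ac; move/(canRL (mulKr b_unit)): bd.
by rewrite !mulr0 => d0 c0; move: cd_neq0; rewrite c0 d0 eqxx.
Qed.

Lemma bipancyclic_prod_field (A : finComUnitRingType) :
  (forall x : A, x != 0 -> x \is a GRing.unit) ->
  bipancyclic (zero_divisor_graph (A * A)%type).
Proof.
move=> A_field; have vE := zdvertex_prod_field A_field.
(* Exchanging the coordinates shows that the two parts have equal size. *)
pose swap (u : A * A) := (u.2, u.1).
have swapK : cancel swap swap by case.
have swapM : {morph swap : x y / x * y} by [].
pose sw := zdvertex_map swapK erefl swapM.
have sw_inj : injective sw := @zdvertex_map_inj _ _ _ _ swapK erefl swapM.
pose P := [set v : zdvertex (A * A)%type | (val v).1 == 0].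
have PCE : #|P| = #|~: P|.
  rewrite -(card_imset (mem P) sw_inj); apply: eq_card => v; rewrite inE.
  apply/imsetP/idP=> [[w wP ->]|vP].
    by move: wP; rewrite !inE !vE negbK.
  exists (sw v); last by apply: val_inj; rewrite /= swapK.
  by move: vP; rewrite !inE vE negbK.
move=> k k_even /andP[k_ge4 k_le].
have cardE : #|zero_divisor_graph (A * A)%type| = (#|P| + #|~: P|)%N.
  by rewrite cardsC.
have lP : (k./2 <= #|P|)%N by lia.
have -> : k = k./2.*2 by lia.
apply: (@has_even_cycle_bipartite (zero_divisor_graph (A * A)%type) P (~: P)) => //.
- by rewrite disjoints_subset setCK.
- move=> v w vP; rewrite inE => wP; rewrite /= /zdadj; apply/andP; split.
    by apply: contraNneq wP => <-.
  move: vP wP; rewrite !inE (vE w) negbK => /eqP v1 /eqP w2.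
  by apply/eqP; congr pair; rewrite /= ?v1 ?w2 ?mul0r ?mulr0.
- lia.
- by rewrite -PCE.
Qed.

(** * Obstruction to long even cycles *)

Lemma not_bipancyclic_prod (A : finComUnitRingType) (d e : A) :
  d != 0 -> e != 0 -> d * e = 0 ->
  (#|A| < 2 * #|[set: {unit A}]|)%N -> (2 < #|[set: {unit A}]|)%N ->
  ~ bipancyclic (zero_divisor_graph (A * A)%type).
Proof.
move=> d_neq0 e_neq0 de0 ltAU U_gt2; set G := zero_divisor_graph _ => bip.
pose elt (x : {unit A} * bool) : A * A := (val x.1, if x.2 then d else 0).
have eltP x : (elt x != 0) && zero_divisor (elt x).
  apply/andP; split.
    apply/eqP=> -[u0 _]; have : val x.1 \is a GRing.unit := valP x.1.
    by rewrite /= u0 unitr0.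
  (* [(0, e)] annihilates both [(u, 0)] and [(u, d)]. *)
  apply/existsP; exists (0, e); apply/andP; split.
    by apply: contraNneq e_neq0 => -[->].
  by apply/eqP; congr pair; rewrite /= ?mulr0 //; case: ifP; rewrite ?mul0r.
pose vtx x : G := Sub (elt x) (eltP x).
have vtx_inj : injective vtx.
  move=> [u b] [u' b'] /(congr1 val) [/val_inj -> ].
  by case: b b' => [] [] // /eqP; rewrite ?(negPf d_neq0) // eq_sym (negPf d_neq0).
pose S := [set vtx x | x in setT].
pose T := [set v : G | (val v).1 == 0].
have cardS : #|S| = (2 * #|[set: {unit A}]|)%N.
  by rewrite card_imset // cardsT card_prod card_bool cardsT mulnC.
(* The second coordinate determines a vertex of [T] and is nonzero, since [(0, 0)] is not a
   vertex. *)
have cardT : (#|T| <= #|A|.-1)%N.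
  rewrite -(cardsC1 (0 : A)) -(card_in_imset (f := fun v : G => (val v).2)).
    apply/subset_leq_card/subsetP=> _ /imsetP[v + ->].
    rewrite !inE => /eqP v1; apply/eqP=> v2; have /andP[/eqP] := valP v.
    by case; rewrite [val v]surjective_pairing v1 v2.
  move=> v w; rewrite !inE => /eqP v1 /eqP w1 vw2; apply: val_inj.
  by rewrite [LHS]surjective_pairing [RHS]surjective_pairing v1 w1 vw2.
have ST x y : x \in S -> adj x y -> y \in T.
  case/imsetP=> -[u b] _ -> /andP[_ /eqP[uy _]]; rewrite inE.
  by rewrite -(mulKr (valP u) (val y).1) [X in _ * X]uy mulr0.
have leSG : (#|S| <= #|G|)%N by apply: max_card.
(* The largest even length misses at most one vertex, so [2 * #|U| <= (#|A| - 1) + 1], against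
   [ltAU]. It is at least 4 because [U_gt2] gives [#|S| >= 6]. *)
have [||_ [c [sz_c uniq_c cyc_c]]] := bip (#|G|./2.*2); [lia|lia|].
have := card_le_long_cycle cyc_c uniq_c ST; rewrite sz_c.
have A_gt0 : (0 < #|A|)%N by apply/card_gt0P; exists 0.
lia.
Qed.

(** * Square roots of -1 modulo prime powers *)

(** The cyclic group of units of F_p has order divisible by 4, and the square of an element of order
    4 is a square root of 1 other than 1. *)
Lemma sqrtN1_mod_prime (p : nat) : prime p -> p = 1 %[mod 4] ->
  exists x : nat, (p %| x ^ 2 + 1)%N.
Proof.
move=> p_prime p_mod4.
have /cyclicP[g gE] := field_unit_group_cyclic [set: {unit 'F_p}]%G.
have og : #[g]%g = p.-1.
  by rewrite orderE -gE card_finField_unit card_Fp.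
have p_gt1 := prime_gt1 p_prime.
have [r [r_gt0 pr]] : exists r, (0 < r)%N /\ p.-1 = (4 * r)%N.
  by exists (p.-1 %/ 4)%N; lia.
pose y := (g ^+ r)%g.
have oy : #[y]%g = 4%N by rewrite orderXdiv og pr ?mulnK // dvdn_mull.
have y4 : (val y ^+ 2) ^+ 2 = 1.
  by rewrite -exprM -[(2 * 2)%N]oy -FinRing.val_unitX expg_order.
have y2 : val y ^+ 2 != 1.
  rewrite -FinRing.val_unitX; apply/eqP=> y2.
  have /eqP : (y ^+ 2 = 1)%g by apply: val_inj.
  by rewrite -order_dvdn oy.
exists (val (val y)).
rewrite (dvdn_pcharf (pchar_Fp p_prime)) natrD natrX natr_Zp.
by move/eqP: y4; rewrite sqrf_eq1 (negPf y2) /= addr_eq0.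
Qed.

(* Newton step: modulo [p], [h] inverts 2 and [- j] inverts [j]. *)
Lemma newton_sqrtN1 (R : comNzRingType) (p q c j h : R) :
  p = 2%:R * h - 1 -> j ^+ 2 + 1 = p * q * c ->
  exists j' c', j' ^+ 2 + 1 = p * (p * q) * c'.
Proof.
move=> pE jE; pose t := c * j * h.
exists (j + t * (p * q)), (c * (2%:R * h * q * c - 1) + t ^+ 2 * q).
(* Isolating [j ^+ 2 + 1] lets [jE] apply; the terms linear in [c] become pqc(1 - 2h) = -p(pq)c,
   which supplies the extra factor [p]. *)
have -> : (j + t * (p * q)) ^+ 2 + 1 =
    (j ^+ 2 + 1) * (1 + 2%:R * c * h * p * q) - 2%:R * c * h * p * q
    + (t * p * q) ^+ 2 by rewrite /t; ring.
by rewrite jE pE; ring.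
Qed.

(** Working over the integers keeps the cofactor [c], which the next Newton step needs. *)
Lemma sqrtN1_mod_prime_power (p m : nat) : prime p -> p = 1 %[mod 4] ->
  exists j c : int, j ^+ 2 + 1 = p%:Z ^+ m.+1 * c.
Proof.
move=> p_prime p_mod4; have p_gt1 := prime_gt1 p_prime.
elim: m => [|m [j [c jE]]].
  have [x /dvdnP[c xE]] := sqrtN1_mod_prime p_prime p_mod4.
  by exists x%:Z, c%:Z; lia.
(* As [p] is odd, (p + 1)/2 inverts 2 modulo [p]. *)
have pE : p%:Z = 2 * (p.+1 %/ 2)%:Z - 1 by lia.
rewrite [p%:Z ^+ _]exprS in jE; do 2!rewrite [p%:Z ^+ _]exprS.
exact: newton_sqrtN1 pE jE.
Qed.

Lemma sqrtN1_Zp (p m : nat) : prime p -> p = 1 %[mod 4] -> (0 < m)%N ->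
  exists j : 'Z_(p ^ m), j * j = -1.
Proof.
move=> p_prime p_mod4; case: m => // m _.
have [j [c jE]] := sqrtN1_mod_prime_power m p_prime p_mod4.
have q_gt1 : (1 < p ^ m.+1)%N.
  by rewrite -[1%N](exp1n m.+1) ltn_exp2r // prime_gt1.
exists j%:~R; apply/eqP; rewrite -addr_eq0 -intrM -expr2 -[1]/(1%:~R) -intrD jE.
by rewrite intrM -[p%:Z]natz -natrX pmulrn intz -pmulrn pchar_Zp ?mul0r.
Qed.

Local Close Scope ring_scope.

Theorem theorem2p3 (p m : nat) (p_prime : prime p)
    (p_mod4 : p = 1 %[mod 4]) (m_ge1 : 1 <= m) :
  bipancyclic (zero_divisor_graph 'Zi_(p ^ m)) <-> m = 1.
Proof.
have p_gt1 := prime_gt1 p_prime; have p_gt0 := prime_gt0 p_prime.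
have p_ge5 : 4 < p by lia.
have q_gt1 : 1 < p ^ m by rewrite -[1](exp1n m) ltn_exp2r.
have [j jj] := sqrtN1_Zp p_prime p_mod4 m_ge1.
have u2 : (2%:R : 'Z_(p ^ m))%R \is a GRing.unit.
  by rewrite unitZpE // coprimeXl // prime_coprime // gtnNdvd //; lia.
rewrite (bipancyclic_gaussian_split jj (mulrV u2)); split=> [|m1]; last first.
  (* A nonzero residue is below [p], hence coprime to [p] and a unit. *)
  subst m; apply: bipancyclic_prod_field => x x_neq0.
  rewrite -(natr_Zp x) unitZpE // coprimeXl // prime_coprime // gtnNdvd ?lt0n //.
  by have := ltn_ord x; rewrite [X in _ < X]Zp_cast // [X in _ < X]expn1.
case: m m_ge1 q_gt1 {j jj u2} => [|[|m]] // _ q_gt1 bip; exfalso.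
have cardU : #|[set: {unit 'Z_(p ^ m.+2)}]| = p.-1 * p ^ m.+1.
  by rewrite card_units_Zp ?totient_pfactor // ltnW.
have natZ_eq0 k : ((k%:R : 'Z_(p ^ m.+2)) == 0)%R = (p ^ m.+2 %| k).
  by rewrite -val_eqE /= val_Zp_nat.
have q'_gt0 : 0 < p ^ m.+1 by rewrite expn_gt0 p_gt0.
(* With the exponent now [m.+2], the factors of zero are [p] and [p ^ m.+1]; the first size
   condition amounts to p < 2(p - 1). *)
apply: (not_bipancyclic_prod (d := p%:R%R) (e := (p ^ m.+1)%:R%R) _ _ _ _ _ bip).
- by rewrite natZ_eq0 gtnNdvd // -[X in X < _]expn1 ltn_exp2l.
- by rewrite natZ_eq0 gtnNdvd // ltn_exp2l.
- by apply/eqP; rewrite -natrM natZ_eq0 -expnS.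
- rewrite cardU card_ord Zp_cast // expnS; nia.
- rewrite cardU; nia.
Qed.
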